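(* Every circular $k$-matching-planar graph has treewidth $O(k^3\log^2 k)$; that is, there is an absolute constant $C$ such that for every integer $k\ge2$, every circular $k$-matching-planar graph has treewidth at most $C k^3\log^2 k$.
   Context: Graphs are finite, simple and undirected. A topological graph is a graph whose vertices are distinct points in the plane, where each edge $vw$ is a non-self-intersecting curve between $v$ and $w$, such that no edge passes through any vertex different from its endpoints, each pair of edges intersect at a finite number of points, and no three edges internally intersect at a common point. A crossing of distinct edges is an internal intersection point of them; two edges cross if they have at least one crossing. A geometric graph is a topological graph in which every edge is a straight line segment. A circular graph is a geometric graph with its vertices positioned on a circle. For an integer $k\ge 0$, a topological graph $G$ is $k$-matching-planar if for every edge $e$ of $G$, every matching (set of pairwise vertex-disjoint edges) amongst the edges of $G$ that cross $e$ has size at most $k$. A circular $k$-matching-planar graph is a circular graph that is $k$-matching-planar. *)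

(* Defs.v *)
From mathcomp Require Import all_boot all_order all_algebra.
From mathcomp Require Import all_classical all_reals all_analysis.

Set Implicit Arguments.
Unset Strict Implicit.
Unset Printing Implicit Defensive.

Import Order.TTheory GRing.Theory Num.Theory.
Import numFieldNormedType.Exports.

Local Open Scope classical_set_scope.
Local Open Scope ring_scope.

Record sgraph := SGraph {
  vertex :> finType;
  adj : rel vertex;
  adj_sym : symmetric adj;
  adj_irrefl : irreflexive adj }.

Definition edges (G : sgraph) : {set {set G}} :=
  [set [set p.1; p.2] | p : G * G & adj p.1 p.2]%SET.

Definition is_matching (G : sgraph) (M : {set {set G}}) : Prop :=
  M \subset edges G /\ finset.trivIset M.

Definition connected_in (G : sgraph) (S : {set G}) : Prop :=
  forall x y : G, x \in S -> y \in S ->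
    connect [rel a b | [&& adj a b, a \in S & b \in S]] x y.

(* Cycles of length at most 2 are discarded: [ucycle] accepts a walk back and
   forth along a single edge. *)
Definition is_tree (T : sgraph) : Prop :=
  [/\ (0 < #|T|)%N,
      connected_in [set: T]%SET
    & forall c : seq T, ucycle (@adj T) c -> (size c <= 2)%N].

Record tree_decomposition (G T : sgraph) (B : T -> {set G}) : Prop :=
  TreeDecomposition {
    td_tree : is_tree T;
    td_edge : forall v w : G, adj v w ->
      exists t : T, (v \in B t) && (w \in B t);
    td_vertex : forall v : G, exists t : T, v \in B t;
    td_connected : forall v : G, connected_in [set t | v \in B t]%SET }.

Definition width (G T : sgraph) (B : T -> {set G}) : nat :=
  (\max_(t : T) #|B t|).-1.

Definition has_width (G : sgraph) (n : nat) : Prop :=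
  exists (T : sgraph) (B : T -> {set G}),
    tree_decomposition B /\ width B = n.

Lemma has_width_trivial (G : sgraph) : has_width G #|G|.-1.
Proof.
pose T := @SGraph unit (fun _ _ => false) (fun _ _ => erefl) (fun _ => erefl).
exists T, (fun _ => [set: G]%SET); split; last first.
  by rewrite /width big_const card_unit /= maxn0 cardsT.
constructor.
- split; first by rewrite card_unit.
  + by move=> [] [] _ _; exact: connect0.
  + by move=> [|a [|b c]] //; rewrite /ucycle /= => /andP[].
- by move=> v w _; exists tt; rewrite !inE.
- by move=> v; exists tt; rewrite inE.
- by move=> v [] [] _ _; exact: connect0.
Qed.

Lemma ex_has_width (G : sgraph) : exists n, `[< has_width G n >].
Proof. by exists #|G|.-1; apply/asboolP; exact: has_width_trivial. Qed.

Definition treewidth (G : sgraph) : nat := ex_minn (ex_has_width G).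

Definition is_arc (R : realType) (a b : R * R) (A : set (R * R)) : Prop :=
  exists gamma : R -> R * R,
    [/\ {within `[0, 1], continuous gamma},
        {in `[0, 1] &, injective gamma},
        gamma 0 = a, gamma 1 = b
      & A = gamma @` `[0, 1]].

Definition edge_interior (R : realType) (V : finType) (pos : V -> R * R)
    (curve : {set V} -> set (R * R)) (e : {set V}) : set (R * R) :=
  curve e `\` (pos @` [set` e]).

(* The values of [curve] outside [edges] are irrelevant. *)
Record topological_graph (R : realType) := TopologicalGraph {
  graph_of :> sgraph;
  pos : graph_of -> R * R;
  curve : {set graph_of} -> set (R * R);
  pos_inj : injective pos;
  curve_arc : forall v w : graph_of, adj v w ->
    is_arc (pos v) (pos w) (curve [set v; w]%SET);
  curve_vertex : forall (e : {set graph_of}) (u : graph_of),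
    e \in edges graph_of -> curve e (pos u) -> u \in e;
  curve_finite : forall e f : {set graph_of},
    e \in edges graph_of -> f \in edges graph_of -> e != f ->
    finite_set (curve e `&` curve f);
  curve_no_triple : forall e f g : {set graph_of},
    e \in edges graph_of -> f \in edges graph_of -> g \in edges graph_of ->
    e != f -> e != g -> f != g ->
    edge_interior pos curve e `&` edge_interior pos curve f
      `&` edge_interior pos curve g = set0 }.

Definition crossing (R : realType) (G : topological_graph R) (e f : {set G})
    (p : R * R) : Prop :=
  [/\ e \in edges G, f \in edges G, e != f
    & (edge_interior (@pos R G) (@curve R G) e
        `&` edge_interior (@pos R G) (@curve R G) f) p].

Definition cross (R : realType) (G : topological_graph R) (e f : {set G}) : Prop :=
  exists p : R * R, crossing e f p.

Definition matching_planar (R : realType) (k : nat) (G : topological_graph R)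
    : Prop :=
  forall e : {set G}, e \in edges G ->
  forall M : {set {set G}}, is_matching M ->
    (forall f : {set G}, f \in M -> cross e f) ->
    (#|M| <= k)%N.

Definition segment (R : realType) (a b : R * R) : set (R * R) :=
  [set ((1 - t) * a.1 + t * b.1, (1 - t) * a.2 + t * b.2) | t in `[0, 1]].

Definition geometric (R : realType) (G : topological_graph R) : Prop :=
  forall v w : G, adj v w -> curve [set v; w]%SET = segment (pos v) (pos w).

Definition circular (R : realType) (G : topological_graph R) : Prop :=
  geometric G /\
  exists (c : R * R) (r : R), 0 < r /\
    forall v : G,
      ((pos v).1 - c.1) ^+ 2 + ((pos v).2 - c.2) ^+ 2 = r ^+ 2.

(* Main.v *)
Require Import Defs.
From mathcomp Require Import all_boot all_order all_algebra.
From mathcomp Require Import all_classical all_reals all_analysis.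
From mathcomp Require Import ssrbool fintype finset zify ring lra.

Set Implicit Arguments.
Unset Strict Implicit.
Unset Printing Implicit Defensive.

(** The treewidth is even linear in [k]: at most [52 * k + 26].

    The first ingredient is the classical passage from balanced separations to
    tree decompositions: if every vertex set [W] of size [12 * s] is split by
    a separation of order at most [s] that leaves at least [s] vertices of [W]
    strictly on each side, then the treewidth is at most [13 * s]
    ([treewidth_of_separations]).

    The second ingredient finds such separations.  Cutting the circle at a
    point that is not a vertex orders the vertices linearly, and chords whose
    ends interleave in this order cross, so the edges interleaving a given edge
    have no matching of size more than [k] and are hit by [2 * k] vertices,
    the ends of a maximal matching.  Hence an edge [ab] yields a separation of
    order at most [2 * k + 2] between the vertices on its two sides, which
    splits [W] as required if both sides carry a fair share of [W].

    Otherwise each edge has a side of small weight.  Two cut points [p < q] of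
    the order then split [W] evenly, but the edges that jump over [p] or [q]
    need not have a small hitting set.  The remedy is to move a cut point
    slightly: among the light edges that jump over [p], take a longest one,
    [ab], and replace [p] by the position of its left end [a].  A light edge
    [cd] jumping over [a] cannot reach [b], being then a longer edge over [p],
    so it interleaves [ab]; hence [2 * k] vertices hit all the light
    edges over [a] ([light_hitting_set]).  The move costs little weight since
    [ab] is light.  After moving both points, the hitting sets and the at most
    two vertices at the cut points separate the vertices between the points
    from the others, with order at most [4 * k + 2] ([linear_splits]). *)

(** * Tree decompositions of rooted trees *)

Local Open Scope nat_scope.

Definition parent_adj (T : finType) (parent : T -> T) : rel T :=
  [rel a b | (a != b) && ((parent a == b) || (parent b == a))].

Lemma parent_adj_sym (T : finType) (parent : T -> T) :
  symmetric (parent_adj parent).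
Proof. by move=> a b; rewrite /parent_adj /= eq_sym orbC. Qed.

Lemma parent_adj_irrefl (T : finType) (parent : T -> T) :
  irreflexive (parent_adj parent).
Proof. by move=> a; rewrite /parent_adj /= eqxx. Qed.

Definition parent_graph (T : finType) (parent : T -> T) : sgraph :=
  SGraph (parent_adj_sym parent) (parent_adj_irrefl parent).

(** Climbing to parents inside [S] ends at [r], the only vertex of [S] that is
    allowed to have its parent outside [S]. *)
Lemma parent_connected (T : finType) (parent : T -> T) (depth : T -> nat)
    (r : T) (S : {set T}) :
  (forall t, t \in S -> t != r -> parent t \in S /\ depth (parent t) < depth t) ->
  connected_in (G := parent_graph parent) S.
Proof.
move=> up.
set e : rel T := [rel a b | [&& parent_adj parent a b, a \in S & b \in S]].
have e_sym : connect_sym e.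
  apply: sym_connect_sym => a b; rewrite /e /= [_ && (b \in S)]andbC.
  by congr (_ && _); rewrite parent_adj_sym.
suff toroot x : x \in S -> connect e x r.
  move=> x y xS yS; apply: (connect_trans (y := r)); first exact: toroot.
  by rewrite e_sym; exact: toroot.
have [n] := ubnP (depth x); elim: n x => // n IH x lexn xS.
have [->|xr] := eqVneq x r; first exact: connect0.
have [pS ltp] := up x xS xr.
apply: connect_trans (IH _ _ pS); last exact: leq_trans ltp _.
apply: connect1; rewrite /e /parent_adj /= xS pS eqxx !andbT.
by apply: contraTneq ltp => <-; rewrite ltnn.
Qed.

(** On a cycle, a vertex of maximal depth would have two distinct neighbours,
    both of which must be its parent. *)
Lemma parent_is_tree (T : finType) (parent : T -> T) (depth : T -> nat) (r : T) :
  parent r = r -> (forall t, t != r -> depth (parent t) < depth t) ->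
  is_tree (parent_graph parent).
Proof.
move=> pr lt_depth; split; first by apply/card_gt0P; exists r.
  by apply: (parent_connected (depth := depth) (r := r)) => t _ /lt_depth; rewrite inE.
move=> c /andP[cyc uc]; rewrite leqNgt; apply/negP => c_gt2.
case: c cyc uc c_gt2 => // x0 c0; move: (x0 :: c0) (mem_head x0 c0) => c x0c.
move=> cyc uc c_gt2.
have [x xc xmax] : exists2 x, x \in c & forall y, y \in c -> depth y <= depth x.
  case: (arg_maxnP (P := mem c) depth x0c) => x /= xc xmax.
  by exists x => // y /xmax.
have up y : y \in c -> parent_adj parent x y -> parent x = y.
  move=> yc /andP[xy /orP[/eqP//|/eqP px]].
  have := xmax _ yc; rewrite leqNgt -px lt_depth //.
  by apply: contraNneq xy => yr; rewrite -px yr pr.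
have nx := up _ (etrans (mem_next c x) xc) (next_cycle cyc xc).
have px : parent x = prev c x.
  by apply: up; rewrite ?mem_prev // parent_adj_sym; apply: prev_cycle.
have nn : next c (next c x) = x by rewrite -nx px next_prev.
case/rot_to: xc => i s rots.
have : uniq (rot i c) by rewrite rot_uniq.
have : 2 < size (rot i c) by rewrite size_rot.
move: nn; rewrite -!(next_rot i uc) rots.
case: s {rots} => [|y [|z s]] //= + _.
rewrite !eqxx; case: ifP => _; rewrite ?eqxx => yx /and3P[];
 rewrite !inE -?yx ?eqxx ?orbT //.
Qed.

(** A tree decomposition of the subgraph induced by [U] over a rooted tree.
    Connectedness of the bags containing a vertex is expressed by [bag_top]:
    only one of them is not entered from its parent.  This form survives the
    joining of two trees under a new root without any talk of paths. *)
Record rooted_td (G : sgraph) (U : {set G}) := RootedTD {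
  node : finType;
  root : node;
  parent : node -> node;
  depth : node -> nat;
  bag : node -> {set G};
  parent_root : parent root = root;
  parent_depth : forall t, t != root -> depth (parent t) < depth t;
  bag_sub : forall t, bag t \subset U;
  bag_vertex : forall v, v \in U -> exists t, v \in bag t;
  bag_edge : forall u v, u \in U -> v \in U -> adj u v ->
    exists t, (u \in bag t) && (v \in bag t);
  bag_top : forall v t t', v \in bag t -> v \in bag t' ->
    (t == root) || (v \notin bag (parent t)) ->
    (t' == root) || (v \notin bag (parent t')) -> t = t' }.

Lemma rooted_td_tree_decomposition (G : sgraph) (D : rooted_td [set: G]) :
  tree_decomposition (T := parent_graph (parent (r := D))) (bag (r := D)).
Proof.
case: D => T r par dep B /= pr pd _ bv be bt; constructor.
- exact: parent_is_tree pr pd.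
- by move=> v w; apply: be; rewrite inE.
- by move=> v; apply: bv; rewrite inE.
move=> v.
have [t0 t0v] := bv v (in_setT v).
have [t tv ttop] : exists2 t, v \in B t & (t == r) || (v \notin B (par t)).
  have [n] := ubnP (dep t0); elim: n t0 t0v => // n IH t t_v lttn.
  case: (boolP ((t == r) || (v \notin B (par t)))) => [|]; first by exists t.
  rewrite negb_or negbK => /andP[tr ptv].
  by apply: IH ptv _; exact: leq_trans (pd _ tr) lttn.
apply: (parent_connected (depth := dep) (r := t)) => t'; rewrite !inE => t'v t't.
have : ~~ ((t' == r) || (v \notin B (par t'))).
  by apply: contra t't => t'top; rewrite (bt _ _ _ tv t'v).
by rewrite negb_or negbK => /andP[/pd ? ->].
Qed.

Definition rooted_td_single (G : sgraph) (U : {set G}) : rooted_td U.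
Proof.
apply: (@RootedTD G U unit tt id (fun=> 0) (fun=> U)) => //.
- by move=> u v uU vU _; exists tt; rewrite uU.
- by move=> v [] [].
Defined.

(** Two decompositions, of the sides of a separation, are joined below a new
    root with bag [S].  The vertices that [S] shares with a side must lie in
    the old root bag of that side, so that their bags stay connected. *)
Section Join.
Variables (G : sgraph) (U1 U2 S : {set G}).
Variables (D1 : rooted_td U1) (D2 : rooted_td U2).
Hypothesis separated : forall u v, u \in U1 :\: U2 -> v \in U2 :\: U1 -> ~~ adj u v.
Hypothesis S_sub : S \subset U1 :|: U2.
Hypothesis S_sep : U1 :&: U2 \subset S.
Hypothesis root1 : S :&: U1 \subset bag (root D1).
Hypothesis root2 : S :&: U2 \subset bag (root D2).

Definition join_parent (t : option (node D1 + node D2)) :=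
  match t with
  | None => None
  | Some (inl a) => if a == root D1 then None else Some (inl (parent a))
  | Some (inr b) => if b == root D2 then None else Some (inr (parent b))
  end.

Definition join_depth (t : option (node D1 + node D2)) : nat :=
  match t with
  | None => 0
  | Some (inl a) => (depth a).+1
  | Some (inr b) => (depth b).+1
  end.

Definition join_bag (t : option (node D1 + node D2)) : {set G} :=
  match t with
  | None => S
  | Some (inl a) => bag a
  | Some (inr b) => bag b
  end.

(** A vertex of [S] has its topmost bag at the new root, and a vertex outside
    [S] occurs on one side only, where uniqueness is inherited. *)
Lemma join_top v t t' : v \in join_bag t -> v \in join_bag t' ->
  (t == None) || (v \notin join_bag (join_parent t)) ->
  (t' == None) || (v \notin join_bag (join_parent t')) -> t = t'.
Proof.
have noneL a : v \in bag a -> v \in S ->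
    v \notin join_bag (join_parent (Some (inl a))) -> False.
  move=> va vS /=; case: eqVneq => [_|ar /= vp]; first by rewrite /= vS.
  have vr : v \in bag (root D1).
    by rewrite (subsetP root1) // inE vS (subsetP (bag_sub a)).
  move/eqP: ar; apply; apply: (bag_top va vr); last by rewrite eqxx.
  by rewrite vp orbT.
have noneR b : v \in bag b -> v \in S ->
    v \notin join_bag (join_parent (Some (inr b))) -> False.
  move=> vb vS /=; case: eqVneq => [_|br /= vp]; first by rewrite /= vS.
  have vr : v \in bag (root D2).
    by rewrite (subsetP root2) // inE vS (subsetP (bag_sub b)).
  move/eqP: br; apply; apply: (bag_top vb vr); last by rewrite eqxx.
  by rewrite vp orbT.
have mixed (a : node D1) (b : node D2) : v \in bag a -> v \in bag b -> v \in S.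
  by move=> va vb; rewrite (subsetP S_sep) // inE (subsetP (bag_sub a)) ?(subsetP (bag_sub b)).
case: t t' => [[a|b]|] [[a'|b']|] //= vt vt'.
- move=> ta ta'; congr (Some (inl _)); apply: (bag_top vt vt').
  + by move: ta; case: eqVneq.
  + by move: ta'; case: eqVneq.
- by move=> ta _; case: (noneL a vt (mixed _ _ vt vt') ta).
- by move=> ta _; case: (noneL a vt vt' ta).
- by move=> ta _; case: (noneR b vt (mixed _ _ vt' vt) ta).
- move=> ta ta'; congr (Some (inr _)); apply: (bag_top vt vt').
  + by move: ta; case: eqVneq.
  + by move: ta'; case: eqVneq.
- by move=> ta _; case: (noneR b vt vt' ta).
- by move=> _ ta'; case: (noneL a' vt' vt ta').
- by move=> _ ta'; case: (noneR b' vt' vt ta').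
Qed.

Definition rooted_td_join : rooted_td (U1 :|: U2).
Proof.
apply: (@RootedTD G _ _ None join_parent join_depth join_bag) => //.
- move=> [[a|b]|] //= _; case: eqVneq => //= ne; rewrite ltnS; exact: parent_depth.
- by move=> [[a|b]|] //=; rewrite subsetU // bag_sub ?orbT.
- by move=> v /setUP[/(bag_vertex D1)|/(bag_vertex D2)] [t vt];
    [exists (Some (inl t))|exists (Some (inr t))].
- move=> u v uU vU uv.
  have [uv1|] := boolP ((u \in U1) && (v \in U1)).
    have /andP[u1 v1] := uv1.
    by have [t tP] := bag_edge D1 u1 v1 uv; exists (Some (inl t)).
  have [uv2 _|] := boolP ((u \in U2) && (v \in U2)).
    have /andP[u2 v2] := uv2.
    by have [t tP] := bag_edge D2 u2 v2 uv; exists (Some (inr t)).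
  have vu : adj v u by rewrite adj_sym.
  move: uU vU (@separated u v) (@separated v u); rewrite !inE uv vu /=.
  case: (u \in U1); case: (u \in U2); case: (v \in U1); case: (v \in U2) => //=;
    by [move=> _ _ /(_ isT isT) | move=> _ _ _ /(_ isT isT)].
- exact: join_top.
Defined.
End Join.

(** * From balanced separations to treewidth *)

Lemma subset_of_card (T : finType) (W U : {set T}) n :
  W \subset U -> #|W| <= n <= #|U| ->
  exists W' : {set T}, [/\ W \subset W', W' \subset U & #|W'| = n].
Proof.
move=> WU /andP[Wn nU].
elim: n Wn nU => [|n IH]; first by rewrite leqn0 => W0 _; exists W; split=> //; apply/eqP.
rewrite leq_eqVlt => /orP[/eqP WE|Wn] nU; first by exists W.
have [W' [WW' W'U W'n]] := IH Wn (ltnW nU).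
have : ~~ (U \subset W') by apply: contraL nU => /subset_leq_card; rewrite W'n -leqNgt.
case/subsetPn => x xU xW'; exists (x |: W'); split.
- exact: subset_trans WW' (subsetUr _ _).
- by rewrite subUset sub1set xU.
- by rewrite cardsU1 xW' W'n.
Qed.

Lemma cardsU_le (T : finType) (A B : {set T}) : #|A :|: B| <= #|A| + #|B|.
Proof. by rewrite cardsU leq_subr. Qed.

Definition separation (G : sgraph) (A B : {set G}) : Prop :=
  A :|: B = [set: G] /\
  forall u v, u \in A :\: B -> v \in B :\: A -> ~~ adj u v.

Definition splits (G : sgraph) (s : nat) (A B W : {set G}) : Prop :=
  [/\ separation A B, #|A :&: B| <= s,
      s <= #|W :&: (A :\: B)| & s <= #|W :&: (B :\: A)|].

(** Induction on [U], keeping a set [W] of at most [N] vertices in the root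
    bag.  Enlarge [W] to size [N] and split it by a separation of order [s]:
    each side loses at least [s] vertices of [W] and gains at most the [s]
    vertices of the separator, so the induction hypothesis applies to the two
    sides, and the new root bag is [W] together with the separator. *)
Lemma rooted_td_of_separations (G : sgraph) (N s : nat) :
  0 < s ->
  (forall W : {set G}, #|W| = N -> exists A B, splits s A B W) ->
  forall U W : {set G}, W \subset U -> #|W| <= N ->
  exists D : rooted_td U,
    W \subset bag (root D) /\ forall t : node D, #|bag t| <= N + s.
Proof.
move=> s_gt0 sep U; have [n] := ubnP #|U|; elim: n U => // n IH U Un W WU WN.
have [smallU|bigU] := leqP #|U| (N + s).
  by exists (rooted_td_single U).
have [W' [WW' W'U cW']] : exists W' : {set G},
    [/\ W \subset W', W' \subset U & #|W'| = N].
  by apply: (subset_of_card WU); rewrite WN (leq_trans (leq_addr s N)) ?(ltnW bigU).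
have [A [B [[AB noedge] cAB WA WB]]] := sep W' cW'.
pose S := (W' :|: A :&: B) :&: U.
have cardS (P Q : {set G}) : s <= #|W' :&: (Q :\: P)| -> P :&: Q = A :&: B ->
    #|S :&: (U :&: P)| <= N.
  move=> WQ PQ.
  have sub : S :&: (U :&: P) \subset (W' :\: (Q :\: P)) :|: (A :&: B).
    apply/subsetP => x; rewrite !inE => /andP[/andP[/orP[xW _|xAB _] /andP[_ xP]]].
      by rewrite xW xP.
    by rewrite xAB orbT.
  apply: (leq_trans (subset_leq_card sub)); apply: (leq_trans (cardsU_le _ _)).
  by move: (cardsID (Q :\: P) W') cAB WQ; rewrite cW'; lia.
have cardU (P Q : {set G}) : s <= #|W' :&: (Q :\: P)| -> #|U :&: P| < n.
  move=> WQ; apply: (@leq_trans #|U|); last by rewrite -ltnS.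
  apply: proper_card; apply/properP; split; first exact: subsetIl.
  have : 0 < #|W' :&: (Q :\: P)| by apply: leq_trans WQ.
  case/card_gt0P => x; rewrite !inE => /and3P[xW xP _].
  by exists x; [exact: (subsetP W'U)|rewrite inE (negbTE xP) andbF].
have subS P : S :&: (U :&: P) \subset U :&: P by exact: subsetIr.
have [D1 [rD1 bD1]] := IH _ (cardU _ _ WB) _ (subS A) (cardS _ _ WB erefl).
have [D2 [rD2 bD2]] := IH _ (cardU _ _ WA) _ (subS B) (cardS _ _ WA (setIC _ _)).
have UE : (U :&: A) :|: (U :&: B) = U by rewrite -setIUr AB setIT.
suff : exists D : rooted_td ((U :&: A) :|: (U :&: B)),
    W \subset bag (root D) /\ forall t : node D, #|bag t| <= N + s.
  by rewrite UE.
have sepU u v : u \in (U :&: A) :\: (U :&: B) -> v \in (U :&: B) :\: (U :&: A) ->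
    ~~ adj u v.
  rewrite !inE => /and3P[uB uU uA] /and3P[vA vU vB].
  apply: noedge; first by move: uB; rewrite !inE uU uA /= andbT.
  by move: vA; rewrite !inE vU vB /= andbT.
have S_sub : S \subset (U :&: A) :|: (U :&: B) by rewrite UE subsetIr.
have S_sep : (U :&: A) :&: (U :&: B) \subset S.
  by apply/subsetP => x; rewrite !inE => /andP[/andP[-> ->] /andP[_ ->]]; rewrite orbT.
exists (rooted_td_join sepU S_sub S_sep rD1 rD2); split.
  by rewrite /= subsetI (subset_trans WW') ?subsetUl // (subset_trans WW').
move=> [[a|b]|] /=; [exact: bD1|exact: bD2|].
apply: leq_trans (subset_leq_card (subsetIl _ _)) _.
by apply: leq_trans (cardsU_le _ _) _; rewrite cW' leq_add2l.
Qed.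

Lemma treewidth_of_separations (G : sgraph) (N s : nat) :
  0 < s ->
  (forall W : {set G}, #|W| = N -> exists A B, splits s A B W) ->
  treewidth G <= N + s.
Proof.
move=> s_gt0 /(rooted_td_of_separations s_gt0) td.
have [|D [_ bD]] := td [set: G] set0 (sub0set _); first by rewrite cards0.
pose T := parent_graph (parent (r := D)).
apply: (@leq_trans (width (T := T) (bag (r := D)))); last first.
  by apply: leq_trans (leq_pred _) _; apply/bigmax_leqP => t _.
rewrite /treewidth; case: ex_minnP => m _; apply; apply/asboolP.
by exists T, (bag (r := D)); split;
   [exact: rooted_td_tree_decomposition|].
Qed.

(** * Balanced separations from a linear order *)

(** The vertices of a maximal matching of [F] meet every member of [F]. *)
Lemma hitting_set_of_matching (T : finType) (F : {set {set T}}) (k : nat) :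
  (forall f, f \in F -> 0 < #|f| <= 2) ->
  (forall M : {set {set T}}, M \subset F -> trivIset M -> #|M| <= k) ->
  exists X : {set T}, #|X| <= 2 * k /\
    forall f, f \in F -> exists2 x, x \in f & x \in X.
Proof.
move=> F2 Fk; pose P (M : {set {set T}}) := (M \subset F) && trivIset M.
have P0 : P set0 by rewrite /P sub0set; apply/trivIsetP => A B; rewrite inE.
case: (arg_maxnP (P := P) (fun M => #|M|) P0) => M /andP[MF Mtriv] Mmax.
exists (cover M); split.
  rewrite -(eqP Mtriv) mulnC; apply: leq_trans (leq_mul (Fk _ MF Mtriv) (leqnn 2)).
  rewrite -sum_nat_const; apply: leq_sum => f fM.
  by have /andP[] := F2 f (subsetP MF _ fM).
move=> f fF; apply/exists_inP; apply: contraT; rewrite negb_exists_in => /forall_inP fX.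
have dis A : A \in M -> [disjoint f & A].
  move=> AM; rewrite disjoint_subset; apply/subsetP => x /fX; rewrite inE.
  by apply: contra => xA; apply/bigcupP; exists A.
have fM : f \notin M.
  apply/negP => /dis; rewrite -setI_eq0 setIid -cards_eq0.
  by have /andP[] := F2 f fF; case: #|f|.
have /Mmax : P (f |: M).
  rewrite /P subUset sub1set fF MF /=; apply/trivIsetP => A B.
  move=> /setU1P[->|AM] /setU1P[->|BM] AB; first by rewrite eqxx in AB.
  - exact: dis.
  - by rewrite disjoint_sym; exact: dis.
  - exact: (trivIsetP Mtriv).
by rewrite /= cardsU1 fM add1n ltnn.
Qed.

Section LinearOrder.
Variables (G : sgraph) (ord : G -> nat) (k : nat).
Hypothesis ord_inj : injective ord.

Definition interleaved (a b c d : G) : bool :=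
  (ord a < ord c < ord b) && ~~ (ord a <= ord d <= ord b).

(** What remains of being circular and [k]-matching-planar once the circle has
    been cut open into a line. *)
Definition interleaving_matching_bound : Prop :=
  forall a b : G, adj a b -> ord a < ord b ->
  forall M : {set {set G}}, is_matching M ->
    (forall f, f \in M -> exists c d,
      [/\ f = [set c; d], adj c d & interleaved a b c d]) ->
    #|M| <= k.

Hypothesis matching_bound : interleaving_matching_bound.

Lemma interleaved_hitting_set (a b : G) : adj a b -> ord a < ord b ->
  exists X : {set G}, #|X| <= 2 * k /\
    forall c d, adj c d -> interleaved a b c d -> (c \in X) || (d \in X).
Proof.
move=> ab ltab.
pose F := [set f in edges G |
  [exists c, exists d, [&& f == [set c; d], adj c d & interleaved a b c d]]].
have [|M MF Mtriv|X [cX hit]] := @hitting_set_of_matching _ F k.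
- move=> f; rewrite inE => /andP[_ /existsP[c /existsP[d /andP[/eqP-> _]]]].
  by rewrite cards2; case: (_ != _).
- apply: (matching_bound ab ltab).
    by split=> //; apply: subset_trans MF _; apply/subsetP => f; rewrite inE => /andP[].
  move=> f /(subsetP MF); rewrite inE => /andP[_ /existsP[c /existsP[d]]].
  by move=> /and3P[/eqP-> cd abcd]; exists c; exists d.
exists X; split=> // c d cd abcd.
have [|x] := hit [set c; d].
  rewrite inE; apply/andP; split; first by apply/imsetP; exists (c, d); rewrite ?inE.
  by apply/existsP; exists c; apply/existsP; exists d; rewrite eqxx cd.
by rewrite !inE => /orP[] /eqP-> ->; rewrite ?orbT.
Qed.

Section Weight.
Variable (W : {set G}).

(** Weights are taken of sets of positions rather than of vertices, which
    reduces their comparison to linear arithmetic. *)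
Definition weight (P : pred nat) : nat := #|[set y in W | P (ord y)]|.

Lemma weight_sub (P Q : pred nat) : subpred P Q -> weight P <= weight Q.
Proof.
move=> PQ; apply/subset_leq_card/subsetP => y; rewrite !inE.
by move=> /andP[-> /PQ].
Qed.

Lemma weight_split (P Q R : pred nat) :
  (forall n, P n -> Q n || R n) -> weight P <= weight Q + weight R.
Proof.
move=> PQR; apply: leq_trans (cardsU_le _ _); apply/subset_leq_card/subsetP => y.
by rewrite !inE => /andP[-> /PQR].
Qed.

Lemma weight_pred1 (n : nat) : weight (pred1 n) <= 1.
Proof.
apply/card_le1_eqP => x y; rewrite !inE => /andP[_ /eqP xn] /andP[_ /eqP yn].
by apply: ord_inj; rewrite xn yn.
Qed.

Lemma weight_true (P : pred nat) : (forall n, P n) -> weight P = #|W|.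
Proof. by move=> PT; apply: eq_card => y; rewrite !inE PT andbT. Qed.

Lemma weight0 (P : pred nat) : (forall n, ~~ P n) -> weight P = 0.
Proof. by move=> P0; apply: eq_card0 => y; rewrite !inE (negbTE (P0 _)) andbF. Qed.

(** As the cut point moves one step to the right, the weight of the prefix
    grows by at most one. *)
Lemma exists_prefix (j : nat) : j <= #|W| -> exists p, weight (fun n => n < p) = j.
Proof.
move=> jW.
have ex : exists p, j <= weight (fun n => n < p).
  exists (\max_y ord y).+1; apply: (leq_trans jW).
  apply/subset_leq_card/subsetP => y yW; rewrite !inE yW ltnS /=.
  exact: leq_bigmax.
case: (ex_minnP ex) => -[|p] jp minp.
  by exists 0; apply/eqP; rewrite eqn_leq jp andbT weight0.
exists p.+1; apply/eqP; rewrite eqn_leq jp andbT.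
have ltp : weight (fun n => n < p) < j.
  by rewrite ltnNge; apply/negP => /minp; rewrite ltnn.
have : weight (fun n => n < p.+1) <= weight (fun n => n < p) + weight (pred1 p).
  by apply: weight_split => n; rewrite ltnS leq_eqVlt orbC.
by have := weight_pred1 p; lia.
Qed.

Definition between (p q : nat) : pred nat := fun n => p < n < q.
Definition beyond (p q : nat) : pred nat := fun n => ~~ (p < n < q).

(** Removing [X] takes at most [s] vertices of [W] away from either side, hence
    the requirement of twice the weight that must remain. *)
Lemma splits_of_cut (p q s : nat) (X : {set G}) :
  (forall u v, adj u v -> between p q (ord u) -> beyond p q (ord v) ->
     (u \in X) || (v \in X)) ->
  #|X| <= s -> 2 * s <= weight (between p q) -> 2 * s <= weight (beyond p q) ->
  exists A B, splits s A B W.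
Proof.
move=> hit Xs Win Wout; pose I := [set y | between p q (ord y)].
exists (I :|: X), (~: I :|: X).
have AB : (I :|: X) :\: (~: I :|: X) = I :\: X.
  by apply/setP => y; rewrite !inE; case: (y \in X); case: (between _ _ _).
have BA : (~: I :|: X) :\: (I :|: X) = (~: I) :\: X.
  by apply/setP => y; rewrite !inE; case: (y \in X); case: (between _ _ _).
have big (J : {set G}) : 2 * s <= #|W :&: J| -> s <= #|W :&: (J :\: X)|.
  move=> WJ; have : #|W :&: J| <= #|W :&: (J :\: X)| + #|X|.
    apply: leq_trans (cardsU_le _ _); apply/subset_leq_card/subsetP => y.
    by rewrite !inE; case: (y \in X); rewrite ?orbT //= orbF.
  by lia.
split.
- split; first by apply/setP => y; rewrite !inE orbACA orbN.
  move=> u v; rewrite AB BA !inE => /andP[uX uI] /andP[vX vI].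
  by apply/negP => /hit /(_ uI vI); rewrite (negbTE uX) (negbTE vX).
- by rewrite -setUIl setICr set0U.
- rewrite AB; apply: big; apply: leq_trans Win _.
  by apply/subset_leq_card/subsetP => y; rewrite !inE.
- rewrite BA; apply: big; apply: leq_trans Wout _.
  by apply/subset_leq_card/subsetP => y; rewrite !inE.
Qed.

(** The point [p'] is the left end of a longest light edge over [p], or [p]
    itself if there is none.  A light edge over [p'] that reaches the right end
    of the longest edge would be over [p] and longer, so every light edge over
    [p'] interleaves the longest one. *)
Lemma light_hitting_set (L p : nat) : exists (p' : nat) (X : {set G}),
  [/\ #|X| <= 2 * k, p' <= p, weight (fun n => p' <= n < p) <= L
    & forall c d, adj c d -> ord c < p' < ord d ->
        weight (between (ord c) (ord d)) < L -> (c \in X) || (d \in X)].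
Proof.
pose over (e : G * G) := [&& adj e.1 e.2, ord e.1 < p < ord e.2
  & weight (between (ord e.1) (ord e.2)) < L].
case: (pickP over) => [e0 e0P|none]; last first.
  exists p, set0; split; rewrite ?cards0 //.
    by rewrite weight0 // => n; lia.
  move=> c d cd cpd Lcd; move: (none (c, d)).
  by rewrite /over /= cd cpd Lcd.
case: (arg_maxnP (P := over) (fun e => ord e.2 - ord e.1) e0P).
move=> [a b] /and3P[/= ab apb Lab] maxab.
have ltab : ord a < ord b by lia.
have [X [cX hit]] := interleaved_hitting_set ab ltab.
exists (ord a), X; split=> //.
- by lia.
- apply: (@leq_trans (weight (pred1 (ord a)) + weight (between (ord a) (ord b)))).
    by apply: weight_split => n; rewrite /between /=; lia.
  by have := weight_pred1 (ord a); lia.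
move=> c d cd cad Lcd; rewrite orbC; apply: hit; first by rewrite adj_sym.
have [ltdb|ledb] := ltnP (ord d) (ord b); first by rewrite /interleaved; lia.
have /= := maxab (c, d); rewrite /over /= cd Lcd.
have -> : ord c < p < ord d by lia.
by move=> /(_ isT); lia.
Qed.

(** With [L = 2 * s], the weight that either side of a cut must have, the set
    [W] has weight [6 * L].  The cut points start at the prefix weights [2 * L]
    and [5 * L] and move left by weight at most [L], so that weight at least
    [L] remains before the first, between the two, and from the second one on.
    Hence an edge that jumps over exactly one cut point is heavy on its outer
    side and so light in the sense of [light_hitting_set]. *)
Lemma linear_splits : #|W| = 12 * (4 * k + 2) ->
  exists A B, splits (4 * k + 2) A B W.
Proof.
set s := 4 * k + 2; move=> cW; pose L := 2 * s.
have compl p q : weight (between p q) + weight (beyond p q) = #|W|.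
  rewrite /weight -(cardsID [set y | between p q (ord y)] W).
  by congr (_ + _); apply: eq_card => y; rewrite !inE // andbC.
have [|light] := boolP [exists e : G * G,
    [&& adj e.1 e.2, ord e.1 < ord e.2,
        L <= weight (between (ord e.1) (ord e.2))
      & L <= weight (beyond (ord e.1) (ord e.2))]].
  case/existsP=> -[a b] /and4P[/= ab ltab Win Wout].
  have [X [cX hit]] := interleaved_hitting_set ab ltab.
  apply: (@splits_of_cut (ord a) (ord b) s (a |: (b |: X))) => //.
    move=> u v uv uI vO; rewrite !inE.
    have [->|va] := eqVneq v a; first by rewrite !orbT.
    have [->|vb] := eqVneq v b; first by rewrite !orbT.
    have : (u \in X) || (v \in X).
      apply: (hit _ _ uv); move: va vb; rewrite -!(inj_eq ord_inj).
      by move: uI vO; rewrite /between /beyond /interleaved; lia.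
    by case/orP => ->; rewrite !orbT.
  by rewrite !cardsU1; lia.
have lightP a b : adj a b -> ord a < ord b ->
    L <= weight (beyond (ord a) (ord b)) -> weight (between (ord a) (ord b)) < L.
  move=> ab ltab Wout; rewrite ltnNge; apply: contra light => Win.
  by apply/existsP; exists (a, b); rewrite /= ab ltab Win.
(* From here on, no edge has weight [L] on both of its sides. *)
have [p Wp] : exists p, weight (fun n => n < p) = 2 * L by apply: exists_prefix; lia.
have [q Wq] : exists q, weight (fun n => n < q) = 5 * L by apply: exists_prefix; lia.
have [p' [X [cX p'p Wp'p hitX]]] := light_hitting_set L p.
have [q' [Y [cY q'q Wq'q hitY]]] := light_hitting_set L q.
have Wp' : L <= weight (fun n => n < p') <= 2 * L.
  have : weight (fun n => n < p) <= weight (fun n => n < p') + weight (fun n => p' <= n < p).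
    by apply: weight_split => n; lia.
  have : weight (fun n => n < p') <= weight (fun n => n < p) by apply: weight_sub => n; lia.
  by lia.
have Wq' : 4 * L <= weight (fun n => n < q') <= 5 * L.
  have : weight (fun n => n < q) <= weight (fun n => n < q') + weight (fun n => q' <= n < q).
    by apply: weight_split => n; lia.
  have : weight (fun n => n < q') <= weight (fun n => n < q) by apply: weight_sub => n; lia.
  by lia.
have Wq's : L <= weight (fun n => q' <= n).
  have : weight predT <= weight (fun n => n < q') + weight (fun n => q' <= n).
    by apply: weight_split => n _; lia.
  by rewrite weight_true //; lia.
(* The separator also contains the vertices at the cut points themselves. *)
pose Z := [set y | ord y == p'] :|: [set y | ord y == q'].
have cZ : #|Z| <= 2.
  have c1 n : #|[set y | ord y == n]| <= 1.
    apply/card_le1_eqP => x y; rewrite !inE => /eqP xn /eqP yn.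
    by apply: ord_inj; rewrite xn yn.
  by apply: leq_trans (cardsU_le _ _) _; have := c1 p'; have := c1 q'; lia.
apply: (@splits_of_cut p' q' s (Z :|: (X :|: Y))).
- move=> u v uv uI vO; rewrite !inE.
  have [_|vp] := eqVneq (ord v) p'; first by rewrite !orbT.
  have [_|vq] := eqVneq (ord v) q'; first by rewrite !orbT.
  have : [|| u \in X, v \in X, u \in Y | v \in Y].
    move: uI vO; rewrite /between /beyond => uI vO.
    have [vltp|plev] := ltnP (ord v) p'.
      have vu : adj v u by rewrite adj_sym.
      have vpu : ord v < p' < ord u by lia.
      have /(hitX _ _ vu vpu)/orP[->|->] : weight (between (ord v) (ord u)) < L.
        apply: lightP vu _ _; first by lia.
        by apply: leq_trans Wq's _; apply: weight_sub => n; rewrite /beyond; lia.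
      1,2: by rewrite ?orbT.
    have uqv : ord u < q' < ord v by lia.
    have /(hitY _ _ uv uqv)/orP[->|->] : weight (between (ord u) (ord v)) < L.
      apply: lightP uv _ _; first by lia.
      have /andP[Lp _] := Wp'; apply: leq_trans Lp _.
      by apply: weight_sub => n; rewrite /beyond; lia.
    1,2: by rewrite ?orbT.
  by case/or4P => ->; rewrite ?orbT.
- have := cardsU_le Z (X :|: Y); have := cardsU_le X Y; lia.
- have : weight (fun n => n < q') <=
      weight (fun n => n <= p') + weight (between p' q').
    by apply: weight_split => n; rewrite /between; lia.
  have : weight (fun n => n <= p') <= weight (fun n => n < p') + weight (pred1 p').
    by apply: weight_split => n /=; lia.
  by have := weight_pred1 p'; lia.
- have /andP[Lp _] := Wp'; apply: leq_trans Lp _.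
  by apply: weight_sub => n; rewrite /beyond; lia.
Qed.

End Weight.

Lemma linear_treewidth : treewidth G <= 52 * k + 26.
Proof.
have -> : 52 * k + 26 = 12 * (4 * k + 2) + (4 * k + 2) by lia.
by apply: treewidth_of_separations => [|W]; [lia|exact: linear_splits].
Qed.

End LinearOrder.

(** * Circular drawings *)

Local Open Scope ring_scope.
Import Order.TTheory GRing.Theory Num.Theory.

(** Twice the signed area of the triangle [a b c]. *)
Definition orient (R : realType) (a b c : R * R) : R :=
  (b.1 - a.1) * (c.2 - a.2) - (b.2 - a.2) * (c.1 - a.1).

(** If each segment has its ends strictly on different sides of the line through
    the other one, the lines meet inside both segments.  The last conclusion
    serves to see that the common point is not an end of either segment. *)
Lemma segments_meet (R : realType) (a b c d : R * R) :
  orient a b c * orient a b d < 0 -> orient c d a * orient c d b < 0 ->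
  exists p, [/\ segment a b p, segment c d p & orient a b p = 0 /\ orient c d p = 0].
Proof.
move: a b c d => [a1 a2] [b1 b2] [c1 c2] [d1 d2].
have weight_in (x y : R) : x * y < 0 -> x / (x - y) \in `[0, 1] /\ x - y != 0.
  move=> xy; have xy0 : x - y != 0.
    by apply/eqP => /subr0_eq xE; move: xy; rewrite xE ltNge -expr2 sqr_ge0.
  split=> //; have sq : 0 < (x - y) ^+ 2 by rewrite exprn_even_gt0.
  have -> : x / (x - y) = (x * (x - y)) / (x - y) ^+ 2 by field.
  rewrite in_itv /= divr_ge0 ?(ltW sq) //=; last by nra.
  by rewrite ler_pdivrMr // mul1r; nra.
move=> /weight_in[mu01 mu0] /weight_in[la01 la0].
set la := _ / _ in la01; set mu := _ / _ in mu01.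
exists ((1 - la) * a1 + la * b1, (1 - la) * a2 + la * b2).
have pE : ((1 - la) * a1 + la * b1, (1 - la) * a2 + la * b2) =
    ((1 - mu) * c1 + mu * d1, (1 - mu) * c2 + mu * d2).
  move: la0 mu0; rewrite /la /mu /orient /= => la0 mu0.
  by congr (_, _); field; rewrite la0 mu0.
split; first by exists la.
- by rewrite pE; exists mu.
- by split; [|rewrite pE]; rewrite /orient /=; ring.
Qed.

(** The rational parametrization of the circle with centre [c] and radius [r],
    projected from the point opposite to the direction [(al, be)]. *)
Definition stereo (R : realType) (c : R * R) (r al be t : R) : R * R :=
  (c.1 + r * (al * (1 - t ^+ 2) - be * (2 * t)) / (1 + t ^+ 2),
   c.2 + r * (be * (1 - t ^+ 2) + al * (2 * t)) / (1 + t ^+ 2)).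

Lemma sqrD1_neq0 (R : realType) (t : R) : 1 + t ^+ 2 != 0.
Proof. by rewrite gt_eqF // ltr_wpDr ?sqr_ge0. Qed.

(** Up to a factor that is positive for [r != 0], the orientation of three points on the circle is
    the Vandermonde determinant of their parameters: the parameters order the
    circle, cut open at the pole. *)
Lemma orient_stereo (R : realType) (c : R * R) (r al be t1 t2 t3 : R) :
  al ^+ 2 + be ^+ 2 = 1 ->
  orient (stereo c r al be t1) (stereo c r al be t2) (stereo c r al be t3) =
  4 * r ^+ 2 / ((1 + t1 ^+ 2) * (1 + t2 ^+ 2) * (1 + t3 ^+ 2)) *
    ((t2 - t1) * (t3 - t1) * (t3 - t2)).
Proof.
move=> ab1; have -> : 4 * r ^+ 2 = 4 * r ^+ 2 * (al ^+ 2 + be ^+ 2).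
  by rewrite ab1 mulr1.
case: c => c1 c2; rewrite /orient /stereo /=.
by field; rewrite !sqrD1_neq0.
Qed.

(** Each of the finitely many points [(u v, w v)] of the unit circle is opposite
    to at most one direction, so one of the [#|V| + 1] directions tried here,
    those with parameters [0, ..., #|V|], is opposite to none. *)
Lemma exists_avoiding_pole (R : realType) (V : finType) (u w : V -> R) :
  exists al be : R, al ^+ 2 + be ^+ 2 = 1 /\
    forall v, u v ^+ 2 + w v ^+ 2 = 1 -> al * u v + be * w v != -1.
Proof.
pose al (m : 'I_#|V|.+1) : R := (1 - m%:R ^+ 2) / (1 + m%:R ^+ 2).
pose be (m : 'I_#|V|.+1) : R := 2 * m%:R / (1 + m%:R ^+ 2).
have ab1 m : al m ^+ 2 + be m ^+ 2 = 1.
  by rewrite /al /be; field; rewrite sqrD1_neq0.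
have [/existsP[m mP]|/existsPn none] := boolP
    [exists m, forall v, (u v ^+ 2 + w v ^+ 2 == 1) ==> (al m * u v + be m * w v != -1)].
  exists (al m), (be m); split=> // v /eqP uw.
  by have /implyP := forallP mP v; apply.
have bad m : {v | (u v = - al m) /\ (w v = - be m)}.
  apply: cid; have /forallPn[v] := none m.
  rewrite negb_imply negbK => /andP[/eqP uw /eqP abuw]; exists v.
  have : (al m + u v) ^+ 2 + (be m + w v) ^+ 2 = 0.
    by have := ab1 m; nra.
  by move=> /eqP; rewrite paddr_eq0 ?sqr_ge0 // !sqrf_eq0 => /andP[/eqP ? /eqP ?]; lra.
pose f m := sval (bad m).
have f_inj : injective f.
  move=> m m' ff; apply/ord_inj/eqP; rewrite -(eqr_nat R).
  have [um wm] := svalP (bad m); have [um' wm'] := svalP (bad m').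
  have aE : al m = al m' by apply: oppr_inj; rewrite -um -um' -/(f m) ff.
  have bE : be m = be m' by apply: oppr_inj; rewrite -wm -wm' -/(f m) ff.
  have mE (i : 'I_#|V|.+1) : i%:R = be i / (1 + al i).
    have a1 : 1 + al i = 2 / (1 + i%:R ^+ 2).
      by rewrite /al; field; rewrite sqrD1_neq0.
    by rewrite a1 /be; field; rewrite sqrD1_neq0.
  by rewrite (mE m) (mE m') aE bE.
by have := leq_card f f_inj; rewrite card_ord ltnn.
Qed.

(** The coordinates are rotated to [(u', w')], where the pole is at [(-1, 0)]; the
    parameter of a point is then [w' / (1 + u')]. *)
Lemma circle_stereo (R : realType) (V : finType) (pos : V -> R * R)
    (c : R * R) (r : R) : 0 < r ->
  (forall v, ((pos v).1 - c.1) ^+ 2 + ((pos v).2 - c.2) ^+ 2 = r ^+ 2) ->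
  exists (al be : R) (t : V -> R), al ^+ 2 + be ^+ 2 = 1 /\
    forall v, pos v = stereo c r al be (t v).
Proof.
move=> r0 onc; have rN0 : r != 0 by rewrite gt_eqF.
pose u v := ((pos v).1 - c.1) / r; pose w v := ((pos v).2 - c.2) / r.
have uw1 v : u v ^+ 2 + w v ^+ 2 = 1.
  by rewrite /u /w !exprMn -mulrDl onc -exprMn divff // expr1n.
have [al [be [ab1 pole]]] := exists_avoiding_pole u w.
pose u' v := al * u v + be * w v; pose w' v := al * w v - be * u v.
exists al, be, (fun v => w' v / (1 + u' v)); split=> // v.
have u'N0 : 1 + u' v != 0 by rewrite addrC addr_eq0 pole.
have uw' : w' v ^+ 2 = (1 - u' v) * (1 + u' v).
  have : u' v ^+ 2 + w' v ^+ 2 = (al ^+ 2 + be ^+ 2) * (u v ^+ 2 + w v ^+ 2).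
    by rewrite /u' /w'; ring.
  by rewrite ab1 uw1 mulr1; move: (u' v) (w' v) => x y xy; lra.
have t2 : (w' v / (1 + u' v)) ^+ 2 = (1 - u' v) / (1 + u' v).
  by rewrite expr_div_n uw'; field.
have uE : u v = al * u' v - be * w' v.
  by rewrite -[LHS]mul1r -ab1 /u' /w'; ring.
have wE : w v = be * u' v + al * w' v.
  by rewrite -[LHS]mul1r -ab1 /u' /w'; ring.
have -> : pos v = (c.1 + r * u v, c.2 + r * w v).
  by rewrite /u /w [LHS]surjective_pairing; congr (_, _); field.
rewrite /stereo t2 uE wE; move: (u' v) (w' v) u'N0 => x y x0.
have x2 : 1 + x + (1 - x) != 0.
  by rewrite (_ : _ + (1 - x) = 2) ?pnatr_eq0 //; ring.
by congr (_, _); field; rewrite x0 x2.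
Qed.

(** Up to positive factors, all four orientations are products of parameter
    differences, and each of the two products is a square times the same
    negative number. *)
Lemma interleaved_orientations (R : realType) (c : R * R) (r al be t1 t2 t3 t4 : R) :
  let P := stereo c r al be in
  0 < r -> al ^+ 2 + be ^+ 2 = 1 -> t1 < t3 < t2 -> (t4 < t1) || (t2 < t4) ->
  orient (P t1) (P t2) (P t3) * orient (P t1) (P t2) (P t4) < 0 /\
  orient (P t3) (P t4) (P t1) * orient (P t3) (P t4) (P t2) < 0.
Proof.
move=> P r0 ab1 /andP[t13 t32] t4out.
have factor_gt0 (x y z : R) :
    0 < 4 * r ^+ 2 / ((1 + x ^+ 2) * (1 + y ^+ 2) * (1 + z ^+ 2)).
  by rewrite divr_gt0 ?mulr_gt0 ?exprn_gt0 ?ltr_wpDr ?sqr_ge0.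
have sign (k1 k2 x y : R) : 0 < k1 -> 0 < k2 -> x * y < 0 ->
    (k1 * x) * (k2 * y) < 0.
  by move=> k10 k20 xy; rewrite mulrACA pmulr_rlt0 ?mulr_gt0.
have sq x y : x < y -> 0 < (y - x) ^+ 2 by move=> xy; rewrite exprn_gt0 ?subr_gt0.
have neg : (t4 - t1) * (t4 - t2) * ((t3 - t1) * (t3 - t2)) < 0.
  rewrite pmulr_rlt0; first by rewrite pmulr_rlt0; lra.
  by case/orP: t4out => ?; [rewrite nmulr_lgt0|rewrite pmulr_rgt0]; lra.
have sq43 : 0 < (t4 - t3) ^+ 2.
  rewrite exprn_even_gt0 //= subr_eq0; case/orP: t4out => ?; lra.
rewrite /P !orient_stereo //; split; apply: sign => //.
  rewrite (_ : _ * _ = (t2 - t1) ^+ 2 *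
     ((t4 - t1) * (t4 - t2) * ((t3 - t1) * (t3 - t2)))); last by ring.
  by rewrite pmulr_rlt0 // sq; lra.
rewrite (_ : _ * _ = (t4 - t3) ^+ 2 *
   ((t4 - t1) * (t4 - t2) * ((t3 - t1) * (t3 - t2)))); last by ring.
by rewrite pmulr_rlt0.
Qed.

Lemma exists_rank (R : realType) (V : finType) (t : V -> R) : injective t ->
  exists ord : V -> nat, injective ord /\
    forall v w, (ord v < ord w)%N = (t v < t w).
Proof.
move=> t_inj; pose ord v := #|[set u | t u < t v]%SET|; exists ord.
have mono v w : t v <= t w -> (ord v <= ord w)%N.
  move=> vw; apply/subset_leq_card/subsetP => u; rewrite !inE => uv.
  exact: lt_le_trans vw.
have lt_ord v w : t v < t w -> (ord v < ord w)%N.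
  move=> vw; apply/proper_card/properP; split; last first.
    by exists v; rewrite !inE ?ltxx.
  by apply/subsetP => u; rewrite !inE => uv; exact: lt_trans vw.
have ltE v w : (ord v < ord w)%N = (t v < t w).
  have [vw|wv] := ltP (t v) (t w); first exact: lt_ord.
  by apply/negbTE; rewrite -leqNgt mono.
split=> // v w vw; apply: t_inj; apply/eqP; rewrite eq_le !leNgt -!ltE vw.
by rewrite ltnn.
Qed.

(** Edges that interleave in the order of the parameters cross in the drawing,
    so a matching that interleaves [ab] is a matching of edges crossing [ab]. *)
Lemma circular_linear_order (R : realType) (G : topological_graph R) (k : nat) :
  circular G -> matching_planar k G ->
  exists ord : G -> nat, injective ord /\ interleaving_matching_bound ord k.
Proof.
move=> [geo [c [r [r0 onc]]]] mp.
have [al [be [t [ab1 posE]]]] := circle_stereo r0 onc.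
have t_inj : injective t by move=> v w vw; apply: (@pos_inj R G); rewrite !posE vw.
have [ord [ord_inj ordE]] := exists_rank t_inj.
exists ord; split=> // a b ab ltab M Mm Mint.
have edgeP (v w : G) : adj v w -> [set v; w]%SET \in edges G.
  by move=> vw; apply/imsetP; exists (v, w); rewrite ?inE.
apply: (mp _ (edgeP _ _ ab) M Mm) => f fM.
have [d [e [fE de abde]]] := Mint f fM.
have [ade adb aeb] : [/\ t a < t d < t b, a != d & b != d].
  move: abde; rewrite /interleaved !ordE => /andP[/andP[ad db] _]; rewrite ad db.
  by split=> //; apply/eqP => dE; move: ad db; rewrite dE ltxx.
have eout : (t e < t a) || (t b < t e).
  by move: abde; rewrite /interleaved -!ordE; lia.
have [abc' dec'] := interleaved_orientations c r0 ab1 ade eout.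
move: abc' dec'; rewrite -!posE => abde' deab'.
have [p [abp dep [oab ode]]] := segments_meet abde' deab'.
exists p; split; rewrite ?fE ?edgeP //.
  apply/eqP => abE; have : d \in [set a; b]%SET by rewrite abE !inE eqxx.
  by rewrite !inE ![d == _]eq_sym (negbTE adb) (negbTE aeb).
split; (split; first by rewrite geo).
- move=> [v /=]; rewrite !inE => /orP[] /eqP-> pE;
    by move: deab'; rewrite pE ode ?mul0r ?mulr0 ltxx.
- move=> [v /=]; rewrite !inE => /orP[] /eqP-> pE;
    by move: abde'; rewrite pE oab ?mul0r ?mulr0 ltxx.
Qed.

Lemma circular_treewidth (R : realType) (G : topological_graph R) (k : nat) :
  circular G -> matching_planar k G -> (treewidth G <= 52 * k + 26)%N.
Proof.
move=> Gcirc Gmp; have [ord [ord_inj ordP]] := circular_linear_order Gcirc Gmp.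
exact: linear_treewidth ord_inj ordP.
Qed.
Theorem theorem1p18 (R : realType) :
  exists C : R, forall k : nat, (2 <= k)%N ->
    forall G : topological_graph R, circular G -> matching_planar k G ->
      (treewidth G)%:R <= C * k%:R ^+ 3 * (ln k%:R) ^+ 2.
Proof.
have ln2 : 0 < ln (2 : R) by rewrite ln_gt0 // ltr1n.
(* For [k >= 2], [52 * k + 26 <= 65 * k], while [k <= k ^+ 3] and [ln 2 <= ln k]. *)
exists (65 / ln 2 ^+ 2) => k k2 G Gcirc Gmp.
have tw := circular_treewidth Gcirc Gmp.
have tw65 : (treewidth G)%:R <= 65 * k%:R :> R by rewrite -natrM ler_nat; lia.
have k2R : 2 <= k%:R :> R by rewrite ler_nat.
have lnk : ln 2 <= ln k%:R :> R by rewrite ler_ln // posrE; lra.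
apply: le_trans tw65 _; rewrite -[leRHS]mulrA mulrAC ler_pdivlMr ?exprn_gt0 //.
rewrite -[leLHS]mulrA ler_pM2l //; apply: ler_pM; rewrite ?ler0n ?sqr_ge0 //.
  by rewrite exprS ler_peMr ?ler0n ?exprn_ege1 //; lra.
by rewrite ler_sqr ?nnegrE; lra.
Qed.
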